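(* Let $(V,\langle\cdot,\cdot\rangle_V)$ be a finite-dimensional real scalar product space, and let $W$ be a Lie triple system in $\mathfrak o(V,\langle\cdot,\cdot\rangle_V)$ with trivial centre, such that the form $-\mathrm{tr}(zz')$ is non-degenerate on $W$. Put $\mathcal L=W+[W,W]$. If $V$ and $\mathcal L$ satisfy condition $(\mathfrak P)$ (stated in the context), then the standard pseudo-metric 2-step nilpotent Lie algebra $\mathcal G=V\oplus W$ admits a basis with rational structure constants.
   Context: A scalar product is a non-degenerate symmetric real bilinear form. $\mathfrak o(V,\langle\cdot,\cdot\rangle_V)$ is the Lie algebra (with commutator bracket) of linear maps $A\colon V\to V$ with $\langle Av,w\rangle_V=-\langle v,Aw\rangle_V$. A subspace $W$ of a Lie algebra is a Lie triple system if $[W,[W,W]]\subset W$; its centre is $\mathfrak Z(W)=\{a\in W\mid [a,b]=0\ \forall b\in W\}$. Condition $(\mathfrak P)$ and its setting: $V=\bigoplus_{j=1}^N V_j$ and $\langle\cdot,\cdot\rangle_V=\bigoplus_j\langle\cdot,\cdot\rangle_{V_j}$, where each $V_j$ is preserved by $W$, is $W$-irreducible (no proper nonzero subspace of $V_j$ is invariant under all elements of $W$), and $\langle\cdot,\cdot\rangle_{V_j}$ is a $W$-invariant scalar product on $V_j$ (all elements of $W$ act skew-symmetrically); the Lie algebra $\mathcal L$ is semisimple, and it admits a basis $\mathcal C_{\mathcal L}$ (for instance a Chevalley basis) with rational structure constants such that $W$ is a rational subspace of $\mathcal L$, i.e. $W$ has a basis contained in $\mathrm{span}_{\mathbb Q}\{\mathcal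 C_{\mathcal L}\}$; and each $V_j$ admits a basis $B_{V_j}$ such that $\zeta(\mathrm{span}_{\mathbb Q}\{B_{V_j}\})\subset\mathrm{span}_{\mathbb Q}\{B_{V_j}\}$ for all $\zeta\in\mathcal C_{\mathcal L}$ and all $j$. The standard pseudo-metric 2-step nilpotent Lie algebra $\mathcal G=V\oplus W$: the scalar product is the orthogonal sum of $\langle\cdot,\cdot\rangle_V$ and $\langle z,z'\rangle=-\mathrm{tr}(zz')$ on $W$ (required to be non-degenerate on $W$); $W$ lies in the centre, and for $v,w\in V$, $[v,w]\in W$ is the unique element with $-\mathrm{tr}([v,w]z)=\langle z(v),w\rangle_V$ for all $z\in W$. *)

(* Defs.v *)
(* The field of real numbers is an arbitrary [R : realType]. *)
From HB Require Import structures.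
From mathcomp Require Import all_boot all_order all_algebra.
From mathcomp Require Import boolp classical_sets reals.

Set Implicit Arguments.
Unset Strict Implicit.
Unset Printing Implicit Defensive.

Import GRing.Theory passmx.
Local Open Scope ring_scope.

Section RationalSpan.
Variables (R : realType) (U : lmodType R).
Implicit Types (X : seq U) (u : U).

Definition spanQ X u : Prop :=
  exists q : 'I_(size X) -> rat, u = \sum_k ratr (q k) *: X`_k.

(* When X is a basis, the [c i j k] are the structure constants of the
   bracket [br] in X. *)
Definition rational_structure_constants (br : U -> U -> U) X : Prop :=
  exists c : 'I_(size X) -> 'I_(size X) -> 'I_(size X) -> rat,
    forall i j : 'I_(size X), br X`_i X`_j = \sum_k ratr (c i j k) *: X`_k.

End RationalSpan.

Section EndomorphismLieAlgebra.
Variables (R : realType) (V : vectType R).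
Implicit Types (A B : 'End(V)) (W L I U : {vspace 'End(V)}).

Definition lie A B : 'End(V) := (A \o B)%VF - (B \o A)%VF.

(* [W1, W2] is the linear span of the brackets; see [liev_subP]. *)
Definition liev (W1 W2 : {vspace 'End(V)}) : {vspace 'End(V)} :=
  <<allpairs lie (vbasis W1) (vbasis W2)>>%VS.

Lemma lie_suml (J : Type) (r : seq J) (a : J -> R) (F : J -> 'End(V)) B :
  lie (\sum_(i <- r) a i *: F i) B = \sum_(i <- r) a i *: lie (F i) B.
Proof.
elim/big_rec2: _ => [|i x y _ IH]; first by rewrite /lie comp_lfun0l comp_lfun0r subrr.
rewrite -IH /lie comp_lfunDl comp_lfunDr -comp_lfunZl -comp_lfunZr.
by rewrite scalerBr opprD addrACA.
Qed.

Lemma lie_anti A B : lie A B = - lie B A.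
Proof. by rewrite /lie opprB. Qed.

Lemma lie_sumr (J : Type) (r : seq J) (a : J -> R) (F : J -> 'End(V)) B :
  lie B (\sum_(i <- r) a i *: F i) = \sum_(i <- r) a i *: lie B (F i).
Proof.
rewrite lie_anti lie_suml -sumrN; apply: eq_bigr => i _.
by rewrite -scalerN -lie_anti.
Qed.

Lemma liev_subP W1 W2 U :
  reflect {in W1 & W2, forall A B, lie A B \in U} (liev W1 W2 <= U)%VS.
Proof.
apply: (iffP idP) => [/span_subvP sU A B W1A W2B | sU].
  rewrite (coord_vbasis W1A) (coord_vbasis W2B) lie_suml memv_suml // => i _.
  rewrite memvZ // lie_sumr memv_suml // => j _; rewrite memvZ // sU //.
  by apply: allpairs_f; rewrite mem_nth ?size_tuple.
apply/span_subvP => _ /allpairsP[[A B] /= [W1A W2B ->]].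
by apply: sU; rewrite vbasis_mem.
Qed.

Definition lie_triple_system W : Prop := (liev W (liev W W) <= W)%VS.

Definition lie_centre W A : Prop :=
  A \in W /\ {in W, forall B, lie A B = 0}.

Definition lie_ideal L I : Prop := (I <= L)%VS /\ (liev L I <= I)%VS.

Definition lie_solvable I : Prop :=
  exists n, iter n (fun U => liev U U) I = 0%VS.

Definition lie_semisimple L : Prop :=
  forall I, lie_ideal L I -> lie_solvable I -> I = 0%VS.

Definition lftrace A : R := \tr (mxof (vbasis {:V}) (vbasis {:V}) A).

Lemma lftraceE (e : (\dim {:V}).-tuple V) A :
  basis_of {:V} e -> lftrace A = \tr (mxof e e A).
Proof.
move=> be; have bv := vbasisP {:V}; rewrite /lftrace.
rewrite -{1}(comp_lfun1r A) (mxof_comp _ _ be) // mxtrace_mulC.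
by rewrite -mxof_comp // comp_lfun1l.
Qed.

Lemma lftrace_scalar : scalar lftrace.
Proof. by move=> a A B; rewrite /lftrace linearP mxtraceD mxtraceZ. Qed.

Lemma lftraceC A B : lftrace (A \o B)%VF = lftrace (B \o A)%VF.
Proof. by rewrite /lftrace !(mxof_comp _ _ (vbasisP _)) mxtrace_mulC. Qed.

Definition trace_form A B : R := - lftrace (A \o B)%VF.

Lemma trace_form_bilinear : bilinear_for *%R (idfun \; *%R) trace_form.
Proof.
split=> [B a A1 A2 | A a B1 B2] /=; rewrite /trace_form.
  by rewrite /= comp_lfunDl -comp_lfunZl lftrace_scalar opprD mulrN.
by rewrite comp_lfunDr -comp_lfunZr lftrace_scalar opprD mulrN.
Qed.

HB.instance Definition _ := bilinear_isBilinear.Build R 'End(V) 'End(V) R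
  *%R (idfun \; *%R) trace_form trace_form_bilinear.

Lemma trace_form_sym A B : trace_form A B = (-1) ^+ false * idfun (trace_form B A).
Proof. by rewrite mul1r /trace_form lftraceC. Qed.

HB.instance Definition _ :=
  isHermitianSesquilinear.Build R 'End(V) false idfun trace_form trace_form_sym.

End EndomorphismLieAlgebra.

Definition nondegenerate_on (R : realType) (V : vectType R)
    (form : {symmetric V}) (U : {vspace V}) : Prop :=
  (U :&: orthov form U = 0)%VS.

Section StandardLieAlgebra.
Variables (R : realType) (V : vectType R).
Variables (form : {symmetric V}) (W : {vspace 'End(V)}).

Definition skew_on (U : {vspace V}) (A : 'End(V)) : Prop :=
  {in U &, forall v w, form (A v) w = - form v (A w)}.

Definition preserves (U : {vspace V}) : Prop :=
  {in W, forall A : 'End(V), (A @: U <= U)%VS}.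

(* [U = 0] is not excluded. *)
Definition irreducible_on (U : {vspace V}) : Prop :=
  forall U' : {vspace V}, (U' <= U)%VS -> preserves U' -> U' = 0%VS \/ U' = U.

(* The scalar product of [Vs j] is the restriction of [form], so [form] is the
   orthogonal sum of these exactly when the [Vs j] are pairwise orthogonal. *)
Definition condition_P (L : {vspace 'End(V)}) : Prop :=
  exists (N : nat) (Vs : 'I_N -> {vspace V}),
    [/\ (\sum_j Vs j)%VS = fullv,
         directv (\sum_j Vs j)
       & forall i j, i != j -> (Vs i <= orthov form (Vs j))%VS] /\
    (forall j, [/\ preserves (Vs j), irreducible_on (Vs j),
                    nondegenerate_on form (Vs j)
                  & {in W, forall A, skew_on (Vs j) A}]) /\
    lie_semisimple L /\
    exists C : seq 'End(V),
      [/\ basis_of L C, rational_structure_constants (@lie R V) C,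
           exists2 X : seq 'End(V), basis_of W X & {in X, forall A, spanQ C A}
         & forall j, exists2 B : seq V, basis_of (Vs j) B
             & {in C, forall (A : 'End(V)) v, spanQ B v -> spanQ B (A v)}].

(* The default value 0 is only reached when no such element of W exists, which
   std_commutatorP excludes as soon as the trace form is non-degenerate on W. *)
Definition std_commutator (v w : V) : subvs_of W :=
  xget 0 [set u | {in W, forall z : 'End(V),
                     trace_form (vsval u) z = form (z v) w}]%classic.

Lemma std_commutator_uniq (u u' : subvs_of W) :
  nondegenerate_on (@trace_form R V) W ->
  {in W, forall z, trace_form (vsval u) z = trace_form (vsval u') z} -> u = u'.
Proof.
move=> ndW eq_uu'; apply/eqP; rewrite -subr_eq0 -(inj_eq val_inj) /= -memv0 -ndW.
rewrite memv_cap memvB ?subvsP //=; apply/mem_orthovP => z Wz.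
by rewrite linearBl; apply/eqP; rewrite subr_eq0; apply/eqP/eq_uu'.
Qed.

Lemma std_commutatorP (v w : V) :
  nondegenerate_on (@trace_form R V) W ->
  {in W, forall z, trace_form (vsval (std_commutator v w)) z = form (z v) w}.
Proof.
move=> ndW; pose e := vbasis W.
have We i : e`_i \in W.
  have [ltiW|leWi] := ltnP i (size e); first by rewrite vbasis_mem ?mem_nth.
  by rewrite nth_default ?mem0v.
pose phi (u : subvs_of W) : 'rV[R]_(\dim W) :=
  \row_i trace_form (vsval u) e`_i.
have phi_lin : linear phi.
  by move=> a x y; apply/rowP=> i; rewrite !mxE linearP /= linearPl.
pose phiL := GRing.isSemilinear.Build _ _ _ _ phi (GRing.semilinear_linear phi_lin).
pose phi' : {linear _ -> _} := HB.pack phi phiL.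
have lin0 (f g : 'End(V) -> R) : scalar f -> scalar g ->
    (forall i : 'I_(\dim W), f e`_i = g e`_i) -> {in W, f =1 g}.
  move=> f_lin g_lin eq_fg z /coord_vbasis->.
  have f0 : f 0 = 0 by have := f_lin (-1) 0 0; rewrite scaler0 addr0 mulN1r addNr.
  have g0 : g 0 = 0 by have := g_lin (-1) 0 0; rewrite scaler0 addr0 mulN1r addNr.
  elim/big_rec: _ => [|i x _ eq_x]; first by rewrite f0 g0.
  by rewrite f_lin g_lin eq_x eq_fg.
have tr_lin u : scalar (trace_form (vsval u)).
  by move=> a x y; rewrite linearPr.
have kphi : lker (linfun phi') == 0%VS.
  rewrite -subv0; apply/subvP => u; rewrite memv_ker lfunE /= => /eqP phi0.
  rewrite memv0; apply/eqP; apply: std_commutator_uniq => //.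
  apply: lin0 => // i.
  have := phi0; move/rowP/(_ i); rewrite !mxE => ->.
  by rewrite linear0 linear0l.
have surj : (limg (linfun phi') = fullv)%VS.
  apply/eqP; rewrite eqEdim subvf limg_dim_eq ?(eqP kphi) ?capv0 //.
  by rewrite !dimvf /dim /= mul1n.
have /memv_imgP[u _ /rowP phiu] :
    \row_(i < \dim W) form ((e`_i : 'End(V)) v) w \in limg (linfun phi').
  by rewrite surj memvf.
rewrite /std_commutator; case: xgetP => [_ _ // |/(_ u)[]] /=.
apply: lin0 => // [a x y|i]; first by rewrite !lfunE /= lfunE linearPl.
by have := phiu i; rewrite lfunE !mxE.
Qed.

(* The Lie bracket of the algebra V (+) W. *)
Definition std_bracket (p q : V * subvs_of W) : V * subvs_of W :=
  (0, std_commutator p.1 q.1).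

Lemma std_commutator_lin (v w : V) a b :
  nondegenerate_on (@trace_form R V) W ->
  std_commutator (a *: v + b) w = a *: std_commutator v w + std_commutator b w.
Proof.
move=> ndW; apply: std_commutator_uniq => // z Wz; rewrite std_commutatorP //.
by rewrite linearP !linearPl; congr (a * _ + _); apply/esym/std_commutatorP.
Qed.

Lemma std_commutator_anti (v w : V) :
  nondegenerate_on (@trace_form R V) W ->
  {in W, forall A, skew_on fullv A} ->
  std_commutator v w = - std_commutator w v.
Proof.
move=> ndW skW; apply: std_commutator_uniq => // z Wz; rewrite std_commutatorP //.
rewrite linearNl; rewrite skW ?memvf //; congr (- _).
by rewrite hermC /= mul1r; apply/esym/std_commutatorP.
Qed.

Lemma std_bracket_lin (p q r : V * subvs_of W) a :
  nondegenerate_on (@trace_form R V) W ->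
  std_bracket (a *: p + q) r = a *: std_bracket p r + std_bracket q r.
Proof.
move=> ndW; rewrite /std_bracket /= std_commutator_lin //.
by congr pair; rewrite /= scaler0 addr0.
Qed.

Lemma std_bracket_anti (p q : V * subvs_of W) :
  nondegenerate_on (@trace_form R V) W ->
  {in W, forall A, skew_on fullv A} ->
  std_bracket p q = - std_bracket q p.
Proof.
move=> ndW skW; rewrite /std_bracket std_commutator_anti //.
by congr pair; rewrite /= oppr0.
Qed.

(* Two-step nilpotency, which contains the Jacobi identity. *)
Lemma std_bracket_2step (p q r : V * subvs_of W) :
  nondegenerate_on (@trace_form R V) W ->
  std_bracket (std_bracket p q) r = 0.
Proof.
move=> ndW; rewrite /std_bracket /=; congr pair.
apply: std_commutator_uniq => // z Wz; rewrite std_commutatorP //.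
by rewrite !linear0 !linear0l.
Qed.

End StandardLieAlgebra.

(* Main.v *)
From HB Require Import structures.
Require Import Defs.
From mathcomp Require Import all_boot all_order all_algebra.
From mathcomp Require Import reals ring.
From mathcomp Require Import complex.

Set Implicit Arguments.
Unset Strict Implicit.
Unset Printing Implicit Defensive.

(** Let [X] be a basis of [W] in the rational span of the basis of [L], and
    [B_j] the given basis of [V_j].  Every [A] in [X] has a rational matrix in
    each [B_j], so the trace form is rational on [X].  If [X] were completed by
    a basis [B'] of [V] with all [form (A b) b'] rational, the coordinates in
    [X] of a commutator of two vectors of [B'] would solve a linear system whose
    matrix (the Gram matrix of the trace form) and right-hand side are rational;
    they would be rational, and [B'] with [X] would be the basis sought.

    The obstacle is that [form] need not be rational on [B_j], even after
    rescaling, because an irreducible module may carry several invariant forms.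
    On [V_j], let [G] be the Gram matrix of [form] and let [z] run over the
    rational matrices of the elements of [X].  Symmetry and invariance,
    [H^T = H] and [z H = - H z^T], form a homogeneous linear system over the
    rationals with the nonzero real solution [G] (unless [V_j = 0], when there is
    nothing to do); hence it has a nonzero rational solution [H]
    ([common_kernel_descent]).  The matrix [M = H G^-1] commutes with every [z].
    By irreducibility the nonzero matrices commuting with every [z] are
    invertible (Schur), so a complex eigenvalue of
    [M] yields a real quadratic equation for [M] ([quadratic_relation]), from
    which [M] or [- M] is the square of some [P = c M + d]
    ([affine_sqrt_up_to_sign]).  As [M G = G M^T], this gives
    [P G P^T = P^2 G = +- H]: changing the basis [B_j] by [P], which commutes with
    the [z], keeps their matrices and makes the Gram matrix rational
    ([congruent_to_rational]).  The pieces [V_j] being mutually orthogonal and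
    preserved by [W], the union of the new bases is the basis [B'] needed. *)

Import Order.TTheory GRing.Theory Num.Theory passmx.
Local Open Scope ring_scope.

(** * Rational solutions and square roots of matrices *)

(** Kernels and intersections of row spaces are computed by Gaussian elimination,
    which commutes with extension of the field of coefficients. *)
Lemma common_kernel_descent (F L : fieldType) (f : {rmorphism F -> L}) m n
    (As : seq 'M[F]_(m, n)) (v : 'rV[L]_m) :
  v != 0 -> {in As, forall A, v *m map_mx f A = 0} ->
  exists2 w : 'rV[F]_m, w != 0 & {in As, forall A, w *m A = 0}.
Proof.
move=> v0 vAs; pose K := (\bigcap_(A <- As) kermx A)%MS.
have mapK : (map_mx f K :=: \bigcap_(A <- As) kermx (map_mx f A))%MS.
  rewrite /K; elim: (As) => [|A s IH]; first by rewrite !big_nil map_mx1.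
  rewrite !big_cons; apply: eqmx_trans (map_capmx _ _ _) _.
  by rewrite map_kermx; apply: cap_eqmx IH.
have vK : (v <= map_mx f K)%MS.
  rewrite mapK big_seq_cond; elim/big_rec: _ => [|A x]; first exact: submx1.
  by rewrite andbT sub_capmx => /vAs/sub_kermxP -> ->.
have /rowV0Pn[w wK w0] : K != 0.
  by apply: contraNneq v0 => K0; move: vK; rewrite K0 map_mx0 submx0.
exists w => // A; rewrite /K in wK; elim: (As) wK => // B s IH.
rewrite big_cons sub_capmx inE => /andP[wB ws] /orP[/eqP->|]; last exact: IH.
exact/sub_kermxP.
Qed.

(** If [l] is a complex eigenvalue of [M], the real polynomial with roots [l] and
    its conjugate has a singular value at [M], so the hypothesis makes it vanish there;
    [a] is the real part of [l] and [m] its modulus. *)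
Lemma quadratic_relation (R : rcfType) n (M : 'M[R]_n.+1) :
    (forall a b, let q := M ^+ 2 + a *: M + b%:M in q = 0 \/ q \in unitmx) ->
  exists a m, 0 <= m /\ M ^+ 2 = (2 * a) *: M - (m ^+ 2)%:M.
Proof.
move=> schur; pose C : closedFieldType := complex R.
pose f := real_complex R : {rmorphism R -> C}.
have [|l] := @closed_rootP C (char_poly (map_mx f M)) _.
  by rewrite size_char_poly.
rewrite -eigenvalue_root_char => /eigenvalueP[v vM v0].
pose a : R := complex.Re l; pose b : R := complex.Im l.
have fE : l ^+ 2 = f (2 * a) * l - f (a ^+ 2 + b ^+ 2).
  rewrite /a /b; case: (l) => x y /=; rewrite /f expr2 /=.
  apply/eqP; rewrite eq_complex /=; apply/andP; split; apply/eqP; ring.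
have m2 : Num.sqrt (a ^+ 2 + b ^+ 2) ^+ 2 = a ^+ 2 + b ^+ 2.
  by rewrite sqr_sqrtr // addr_ge0 // sqr_ge0.
exists a, (Num.sqrt (a ^+ 2 + b ^+ 2)); rewrite sqrtr_ge0 m2.
split=> //; case: (schur (- (2 * a)) (a ^+ 2 + b ^+ 2)) => [q0|].
  by move/eqP: q0; rewrite -addrA addr_eq0 scaleNr => /eqP->; rewrite opprD opprK.
rewrite -(map_unitmx f) => qU; case/negP: v0; rewrite -(mulmxK qU v).
set q := map_mx _ _; suff -> : v *m q = 0 by rewrite mul0mx.
rewrite /q !map_mxD map_mxZ map_scalar_mx !mulmxDr -scalemxAr vM expr2 map_mxM mulmxA.
rewrite vM -scalemxAl vM mul_mx_scalar !scalerA -2!scalerDl -expr2.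
by rewrite fE rmorphN mulNr [_ - _ - _]addrAC subrr add0r addNr scale0r.
Qed.

(** From [M^2 = 2 a M - m^2] with [s] the sign of [a] one gets
    [(M + s m)^2 = 2 (a + s m) M = 2 s (|a| + m) M], and [|a| + m > 0] unless
    [M^2 = 0].  The sign takes care of the negative scalar matrices, which are
    not squares of real polynomials in themselves. *)
Lemma affine_sqrt_up_to_sign (R : rcfType) n (M : 'M[R]_n.+1) :
    (forall a b, let q := M ^+ 2 + a *: M + b%:M in q = 0 \/ q \in unitmx) ->
    M \in unitmx ->
  exists (s : bool) c d, (c *: M + d%:M) ^+ 2 = (-1) ^+ s *: M.
Proof.
move=> schur MU; have [a [m [m0 M2]]] := quadratic_relation schur.
have k0 : 0 < 2 * (`|a| + m).
  rewrite pmulr_rgt0 // lt_def addr_ge0 // andbT.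
  apply: contraL MU; rewrite paddr_eq0 // normr_eq0 => /andP[/eqP a0 /eqP m_0].
  move: M2; rewrite a0 m_0.
  rewrite mulr0 scale0r expr0n -scalemx1 scale0r subr0 => M2.
  apply/negP => MU; have M_0 : M = 0 by rewrite -(mulmxK MU M) -[M *m M]expr2 M2 mul0mx.
  by move: MU; rewrite M_0 unitmxE det0 unitr0.
pose s := a < 0; pose k := (Num.sqrt (2 * (`|a| + m)))^-1.
exists s, k, (k * ((-1) ^+ s * m)).
rewrite -scalemx1 -scalerA scalemx1 -scalerDr exprZn exprVn sqr_sqrtr ?ltW //.
have -> : (M + ((-1) ^+ s * m)%:M) ^+ 2 = (2 * (`|a| + m)) *: ((-1) ^+ s *: M).
  have m2 : (-1) ^+ s * m * ((-1) ^+ s * m) = m ^+ 2.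
    by rewrite mulrACA -expr2 sqrr_sign mul1r -expr2.
  rewrite expr2 mulrDl !mulrDr -expr2 M2 -!mulmxE mul_mx_scalar mul_scalar_mx.
  rewrite -scalar_mxM m2 {1}[a]realEsign ?num_real // -/s.
  by apply/matrixP => i j; rewrite !mxE; ring.
by rewrite scalerA mulVf ?scale1r // gt_eqF.
Qed.

(** The matrices [z] act on row vectors, on which [G] is an invariant symmetric
    form; the last hypothesis is the conclusion of Schur's lemma. *)
Lemma congruent_to_rational (R : realType) n (Z : seq 'M[rat]_n) (G : 'M[R]_n) :
    let real := map_mx (ratr : rat -> R) in
    G \in unitmx -> G^T = G ->
    {in Z, forall z, real z *m G = - (G *m (real z)^T)} ->
    (forall M, {in Z, forall z, real z *m M = M *m real z} ->
       M = 0 \/ M \in unitmx) ->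
  exists (P : 'M[R]_n) (H : 'M[rat]_n),
    [/\ P \in unitmx, {in Z, forall z, real z *m P = P *m real z}
      & P *m G *m P^T = real H].
Proof.
case: n Z G => [|n] Z G real GU Gsym skewG schur.
  exists 1%:M, 0; split=> [|z _|]; rewrite ?unitmx1 ?mulmx1 ?mul1mx //.
  by apply/matrixP => -[].
(* Invariance and symmetry of an unknown matrix, as linear equations. *)
pose inv (z : 'M[rat]_n.+1) := lin_mx (mulmx z \+ mulmxr z^T).
pose sym := lin_mx (@trmx rat n.+1 n.+1 \- idfun).
have mapE (z : 'M[rat]_n.+1) : real z^T = (real z)^T by rewrite /real map_trmx.
have [w w0 wK] : exists2 w : 'rV_(n.+1 * n.+1),
    w != 0 & {in sym :: map inv Z, forall A, w *m A = 0}.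
  apply: (@common_kernel_descent _ _ (ratr : {rmorphism rat -> R}) _ _ _ (mxvec G)).
    apply: contraTneq GU => /eqP; rewrite mxvec_eq0 => /eqP ->.
    by rewrite unitmxE det0 unitr0.
  move=> A; rewrite inE => /orP[/eqP->|/mapP[z Zz ->]].
    rewrite (map_lin_mx (gf := @trmx R n.+1 n.+1 \- idfun)); last first.
      by move=> X /=; rewrite map_mxB map_trmx.
    by rewrite mul_vec_lin /= Gsym subrr linear0.
  rewrite (map_lin_mx (gf := mulmx (real z) \+ mulmxr (real z^T))); last first.
    by move=> X /=; rewrite map_mxD !map_mxM.
  by rewrite mul_vec_lin /= mapE skewG // addNr linear0.
have vec0 A : mxvec A = 0 -> A = 0 by move=> /eqP; rewrite mxvec_eq0 => /eqP.
pose H := vec_mx w.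
have Hsym : H^T = H.
  apply/eqP; rewrite -subr_eq0; apply/eqP/vec0.
  rewrite -[_ - _]/((@trmx rat n.+1 n.+1 \- idfun) H) -mul_vec_lin vec_mxK.
  by rewrite wK ?mem_head.
have skewH : {in Z, forall z, z *m H = - (H *m z^T)}.
  move=> z Zz; apply/eqP; rewrite -addr_eq0; apply/eqP/vec0.
  rewrite -[_ + _]/((mulmx z \+ mulmxr z^T) H) -mul_vec_lin vec_mxK wK //.
  by rewrite inE map_f ?orbT.
(* [M] compares the two invariant forms [H] and [G]. *)
have [M MG] : exists M, M *m G = real H.
  by exists (real H *m invmx G); rewrite mulmxKV.
have Mcomm : {in Z, forall z, real z *m M = M *m real z}.
  move=> z Zz; apply: (can_inj (mulmxK GU)).
  rewrite -!mulmxA MG skewG // mulmxN mulmxA MG -mapE /real -!map_mxM skewH //.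
  by rewrite map_mxN.
have MU : M \in unitmx.
  have [M0|//] := schur _ Mcomm; case/negP: w0.
  rewrite -[w]vec_mxK mxvec_eq0 -(map_mx_eq0 (ratr : {rmorphism rat -> R})).
  by rewrite -/(real _) -MG M0 mul0mx.
have [a b||s [c [d P2]]] := @affine_sqrt_up_to_sign _ _ M.
- apply: schur => z Zz; rewrite expr2 !mulmxDr !mulmxDl -scalemxAr -scalemxAl Mcomm //.
  by rewrite -mulmxE !mulmxA Mcomm // -!mulmxA Mcomm // scalar_mxC.
- by [].
pose P := c *: M + d%:M.
have MGs : G *m M^T = M *m G by rewrite -{1}Gsym -trmx_mul MG -mapE Hsym.
have PG : G *m P^T = P *m G.
  by rewrite linearD /= linearZ /= tr_scalar_mx mulmxDr mulmxDl -scalemxAr MGs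
    scalemxAl scalar_mxC.
exists P, ((-1) ^+ s *: H); split.
- have: P ^+ 2 \in unitmx by rewrite P2 unitmxZ // unitrX // unitrN1.
  by rewrite expr2 -mulmxE unitmx_mul andbb.
- by move=> z Zz; rewrite mulmxDr mulmxDl -scalemxAr -scalemxAl Mcomm // scalar_mxC.
rewrite -mulmxA PG mulmxA mulmxE -expr2 P2 -mulmxE -scalemxAl MG.
by rewrite /real map_mxZ rmorphXn rmorphN1.
Qed.

(** * Rational spans *)

Lemma spanQ_sum (R : realType) (U : lmodType R) (X : seq U)
    (I : finType) (q : I -> rat) (F : I -> U) :
  (forall i, spanQ X (F i)) -> spanQ X (\sum_i ratr (q i) *: F i).
Proof.
move=> /fin_all_exists[r Fr]; exists (fun k => \sum_i q i * r i k).
under eq_bigr do rewrite Fr scaler_sumr; rewrite exchange_big /=.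
apply: eq_bigr => k _; rewrite rmorph_sum scaler_suml; apply: eq_bigr => i _.
by rewrite rmorphM scalerA.
Qed.

Lemma spanQ_mem (R : realType) (U : lmodType R) (X : seq U) u : u \in X -> spanQ X u.
Proof.
move=> uX; have lt_u : (index u X < size X)%N by rewrite index_mem.
exists (fun k => (k == Ordinal lt_u)%:R); rewrite (bigD1 (Ordinal lt_u)) //=.
rewrite eqxx rmorph1 scale1r nth_index // big1 ?addr0 // => k /negPf->.
by rewrite rmorph0 scale0r.
Qed.

Lemma spanQ_map (R : realType) (U U' : lmodType R) (f : {linear U -> U'})
    (X : seq U) (Y : seq U') u :
  {in X, forall x, spanQ Y (f x)} -> spanQ X u -> spanQ Y (f u).
Proof.
move=> fXY [q ->]; rewrite linear_sum; under eq_bigr do rewrite linearZ /=.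
by apply: spanQ_sum => k; apply: fXY; rewrite mem_nth.
Qed.

(** * Gram matrices *)

Lemma coords_in_basis (R : realType) (V : vectType R) (U : {vspace V}) (B : seq V) v :
  basis_of U B -> v \in U -> exists x : 'rV_(size B), v = \sum_i x 0 i *: B`_i.
Proof.
move=> bB vU; exists (\row_i coord (in_tuple B) i v).
by rewrite {1}(coord_basis (X := in_tuple B) bB vU); apply: eq_bigr => i _; rewrite mxE.
Qed.

Lemma row_sum_inj (R : realType) (V : vectType R) (U : {vspace V}) (B : seq V)
    (x : 'rV_(size B)) :
  basis_of U B -> \sum_i x 0 i *: B`_i = 0 -> x = 0.
Proof.
move=> /basis_free/(@freeP _ _ _ (in_tuple B)) freeB sum0.
by apply/rowP => i; rewrite mxE (freeB _ sum0).
Qed.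

Lemma form_row_sum (R : realType) (V : vectType R) (form : {symmetric V})
    (X : seq V) (x y : 'rV_(size X)) :
  form (\sum_i x 0 i *: X`_i) (\sum_i y 0 i *: X`_i) =
  (x *m (\matrix_(i, j) form X`_i X`_j) *m y^T) 0 0.
Proof.
rewrite linear_sumr mxE; apply: eq_bigr => j _.
rewrite linearZr /= linear_sumlz !mxE mulrC; congr (_ * _).
by apply: eq_bigr => i _; rewrite !mxE linearZl.
Qed.

(** A row vector killed by the Gram matrix is the coordinate vector of an element
    of [U] orthogonal to [U]. *)
Lemma gram_unitmx (R : realType) (V : vectType R) (form : {symmetric V})
    (U : {vspace V}) (X : seq V) :
  basis_of U X -> nondegenerate_on form U ->
  \matrix_(i < size X, j < size X) form X`_i X`_j \in unitmx.
Proof.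
move=> bX ndU; rewrite -row_free_unit -kermx_eq0; apply/rowV0P => x /sub_kermxP xG.
have x0 : \sum_i x 0 i *: X`_i = 0.
  apply/eqP; rewrite -memv0 -ndU memv_cap; apply/andP; split.
    by apply: memv_suml => i _; rewrite memvZ // (basis_mem bX) ?mem_nth.
  apply/mem_orthovP => v /(coords_in_basis bX)[y ->].
  by rewrite form_row_sum xG mul0mx mxE.
exact: (row_sum_inj bX).
Qed.

Lemma rational_mx (R : realType) m n (M : 'M[R]_(m, n)) :
  (forall i j, exists q, M i j = ratr q) -> exists M0, M = map_mx ratr M0.
Proof.
move=> ratM.
have /fin_all_exists[q qE] : forall ij : 'I_m * 'I_n, exists q, M ij.1 ij.2 = ratr q.
  by case.
by exists (\matrix_(i, j) q (i, j)); apply/matrixP => i j; rewrite !mxE -(qE (i, j)).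
Qed.

(** The coordinates of [u] in [X] solve a linear system with rational
    coefficients, whose matrix is the Gram matrix of [X]. *)
Lemma spanQ_of_rational_pairings (R : realType) (V : vectType R)
    (form : {symmetric V}) (U : {vspace V}) (X : seq V) u :
    basis_of U X -> nondegenerate_on form U -> u \in U ->
    {in X &, forall x y, exists q, form x y = ratr q} ->
    {in X, forall x, exists q, form u x = ratr q} ->
  spanQ X u.
Proof.
move=> bX ndU /(coords_in_basis bX)[x ->] gramQ pairQ.
set G := \matrix_(i < size X, j < size X) form X`_i X`_j.
have GU : G \in unitmx := gram_unitmx bX ndU.
have [G0 GE] : exists G0, G = map_mx ratr G0.
  by apply: rational_mx => i j; rewrite mxE; apply: gramQ; rewrite mem_nth.
have [r xG] : exists r, x *m G = map_mx ratr r.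
  apply: rational_mx => k j; have [q qE] := pairQ X`_j (mem_nth 0 (ltn_ord j)).
  exists q; rewrite -qE ord1 mxE linear_sumlz.
  by apply: eq_bigr => i _; rewrite mxE linearZl.
exists (fun i => (r *m invmx G0) 0 i); apply: eq_bigr => i _; congr (_ *: _).
by rewrite -(mulmxK GU x) xG GE -map_invmx -map_mxM mxE.
Qed.

(** * A rational basis for an irreducible invariant form *)

(** The new basis is obtained from [B] by the matrix [P] of
    [congruent_to_rational]; as [P] commutes with the action of [X], the pairings
    become entries of products of rational matrices. *)
Lemma rational_basis_of_irreducible (R : realType) (V : vectType R)
    (form : {symmetric V}) (W : {vspace 'End(V)}) (X : seq 'End(V))
    (U : {vspace V}) (B : seq V) :
    basis_of W X -> basis_of U B -> irreducible_on W U ->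
    nondegenerate_on form U -> {in W, forall A, skew_on form U A} ->
    {in X & B, forall (A : 'End(V)) b, spanQ B (A b)} ->
  exists2 B' : seq V, basis_of U B' &
    {in X, forall A : 'End(V), {in B' &, forall b b', exists q, form (A b) b' = ratr q}}.
Proof.
move=> bX bB irrU ndU skewU XB; set n := size B.
pose real : 'M[rat]_n -> 'M[R]_n := map_mx ratr.
have [zs zsE] : exists zs : 'I_(size X) -> 'M[rat]_n,
    forall (k : 'I_(size X)) (i : 'I_n), X`_k B`_i = \sum_j ratr (zs k i j) *: B`_j.
  suff: forall k : 'I_(size X), exists z : 'M[rat]_n,
      forall i : 'I_n, X`_k B`_i = \sum_j ratr (z i j) *: B`_j.
    by move/fin_all_exists.
  move=> k; have /fin_all_exists[q qE] : forall i : 'I_n, spanQ B (X`_k B`_i).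
    by move=> i; apply: XB; rewrite mem_nth.
  by exists (\matrix_(i, j) q i j) => i; under eq_bigr do rewrite mxE.
(* Coordinates in [B] identify row vectors with the elements of [U]. *)
pose h (x : 'rV[R]_n) := \sum_i x 0 i *: B`_i.
have h_lin : linear h.
  move=> a x y; rewrite /h scaler_sumr -big_split; apply: eq_bigr => i _ /=.
  by rewrite !mxE scalerDl scalerA.
pose hL : {linear 'rV[R]_n -> V} := HB.pack h
  (GRing.isSemilinear.Build _ _ _ _ h (GRing.semilinear_linear h_lin)).
have h_inj x : h x = 0 -> x = 0.
  exact: (row_sum_inj bB).
have hB (i : 'I_n) : h (delta_mx 0 i) = B`_i.
  rewrite /h (bigD1 i) //= mxE !eqxx scale1r big1 ?addr0 // => j /negPf.
  by rewrite mxE eqxx eq_sym => ->; rewrite scale0r.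
have hU x : h x \in U.
  by apply: memv_suml => i _; rewrite memvZ // (basis_mem bB) ?mem_nth.
have Ah (k : 'I_(size X)) x : X`_k (h x) = h (x *m real (zs k)).
  rewrite /h linear_sum; under eq_bigr do rewrite linearZ /= zsE scaler_sumr.
  rewrite exchange_big; apply: eq_bigr => j _ /=; rewrite mxE scaler_suml.
  by apply: eq_bigr => i _; rewrite !mxE scalerA.
pose G := \matrix_(i < n, j < n) form B`_i B`_j.
have GU : G \in unitmx := gram_unitmx bB ndU.
pose Z := codom zs.
have skewZ : {in Z, forall z, real z *m G = - (G *m (real z)^T)}.
  move=> _ /codomP[k ->]; apply/matrixP => i j.
  have XW : X`_k \in W by rewrite (basis_mem bX) ?mem_nth.
  have := skewU _ XW _ _ (hU (delta_mx 0 i)) (hU (delta_mx 0 j)).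
  rewrite !Ah !form_row_sum -/G => skew_ij.
  have entry (N : 'M[R]_n) :
      ((delta_mx 0 i : 'rV_n) *m N *m (delta_mx 0 j : 'rV_n)^T) 0 0 = N i j.
    by rewrite trmx_delta -rowE -colE !mxE.
  rewrite -(entry (_ *m G)) -(entry (- _)) mulmxN mulNmx [RHS]mxE !mulmxA.
  by rewrite skew_ij trmx_mul !mulmxA.
(* Schur's lemma: the image of a matrix that commutes with the action is an
   invariant subspace. *)
have schur M : {in Z, forall z, real z *m M = M *m real z} -> M = 0 \/ M \in unitmx.
  move=> commM; pose U' := limg (linfun (hL \o mulmxr M)).
  have U'P x : h (x *m M) \in U'.
    by apply/memv_imgP; exists x; rewrite ?memvf ?lfunE.
  have [||U'0|U'U] := irrU U'.
  - by apply/subvP => _ /memv_imgP[x _ ->]; rewrite lfunE /=; apply: hU.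
  - move=> A AW; apply/subvP => _ /memv_imgP[_ /memv_imgP[x _ ->] ->].
    rewrite lfunE /= (coord_basis (X := in_tuple X) bX AW) sum_lfunE.
    apply: memv_suml => k _; rewrite lfunE /= memvZ // Ah.
    by rewrite -mulmxA -commM ?codom_f // mulmxA U'P.
  - left; apply/row_matrixP => i; rewrite row0 rowE; apply: h_inj.
    by apply/eqP; rewrite -memv0 -U'0.
  right; rewrite -row_full_unit -sub1mx; apply/row_subP => i.
  have: h (delta_mx 0 i) \in U' by rewrite U'U.
  move=> /memv_imgP[x _]; rewrite lfunE /= => /eqP; rewrite -subr_eq0.
  rewrite -(linearB hL) => /eqP/h_inj/eqP; rewrite subr_eq0 rowE mulmx1 => /eqP->.
  exact: submxMl.
have [|P [H [PU commP PG]]] := congruent_to_rational GU _ skewZ schur.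
  by apply/matrixP => i j; rewrite !mxE hermC /= mul1r.
exists [seq h (row i P) | i <- enum 'I_n].
  rewrite basisEdim size_map size_enum_ord; apply/andP; split; last first.
    by rewrite (size_basis (X := in_tuple B) bB).
  rewrite -(span_basis bB); apply/span_subvP => b /(nthP 0)[i ltin <-].
  rewrite -(hB (Ordinal ltin)) -(mulmxKV PU (delta_mx _ _)).
  rewrite mulmx_sum_row -[h _]/(hL _) linear_sum memv_suml // => j _.
  by rewrite linearZ memvZ //=; apply: memv_span; apply: map_f; rewrite mem_enum.
move=> A /(nthP 0)[k ltk <-] _ _ /mapP[i _ ->] /mapP[j _ ->].
exists ((zs (Ordinal ltk) *m H) i j).
rewrite (Ah (Ordinal ltk)) form_row_sum -/G -!row_mul -commP ?codom_f // tr_row colE.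
by rewrite mulmxA -colE -!mulmxA [P *m _]mulmxA PG -map_mxM !mxE.
Qed.

(** * Traces, unions and products *)

Lemma spanQ_coord (R : realType) (V : vectType R) n (e : n.-tuple V) u i :
  free e -> spanQ e u -> exists q, coord e i u = ratr q.
Proof.
move=> free_e [q ->]; exists (\sum_k q k * (k == i :> nat)%:R).
rewrite linear_sum rmorph_sum; apply: eq_bigr => k _.
rewrite linearZ /= (coord_free (cast_ord (size_tuple e) k) i free_e).
by rewrite rmorphM rmorph_nat.
Qed.

Lemma lftrace_rational (R : realType) (V : vectType R) (B : seq V) (A : 'End(V)) :
    basis_of fullv B -> {in B, forall b, spanQ B (A b)} ->
  exists q, lftrace A = ratr q.
Proof.
move=> bB AB; have sB : size B == \dim {:V}.
  by rewrite (size_basis (X := in_tuple B) bB).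
pose e := Tuple sB; rewrite (@lftraceE _ _ e _ bB).
have entryQ (i : 'I_(\dim {:V})) : exists q, mxof e e A i i = ratr q.
  rewrite !mxE /= vecof_delta.
  apply: (@spanQ_coord _ _ _ e); first exact: basis_free bB.
  by apply: AB; rewrite mem_nth ?(eqP sB).
have /fin_all_exists[q qE] := entryQ.
by exists (\sum_i q i); rewrite rmorph_sum; apply: eq_bigr => i _; apply: qE.
Qed.

Lemma mem_bigcat_ord (T : eqType) n (F : 'I_n -> seq T) x :
  reflect (exists i, x \in F i) (x \in \big[cat/[::]]_i F i).
Proof.
by rewrite (big_morph (fun s => x \in s) (mem_cat x) (in_nil x)) big_orE; apply: existsP.
Qed.

(** The injections into [U * V] are packaged as linear maps so that they can be
    pushed through spans and rational spans. *)
Section PairInjections.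
Variables (R : pzRingType) (U V : lmodType R).

Definition pairl (u : U) : U * V := (u, 0).
Definition pairr (v : V) : U * V := (0, v).

Lemma pairl_linear : linear pairl.
Proof. by move=> a x y; congr pair; rewrite /= scaler0 addr0. Qed.
Lemma pairr_linear : linear pairr.
Proof. by move=> a x y; congr pair; rewrite /= scaler0 addr0. Qed.

HB.instance Definition _ :=
  GRing.isSemilinear.Build R U (U * V)%type _ pairl (GRing.semilinear_linear pairl_linear).
HB.instance Definition _ :=
  GRing.isSemilinear.Build R V (U * V)%type _ pairr (GRing.semilinear_linear pairr_linear).

End PairInjections.
Arguments pairl {R U V}.
Arguments pairr {R U V}.

Lemma mem_span_map (R : realType) (V V' : vectType R) (f : {linear V -> V'})
    (B : seq V) v :
  basis_of fullv B -> f v \in <<map f B>>%VS.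
Proof.
move=> bB; have [x ->] := coords_in_basis bB (memvf v).
rewrite linear_sum memv_suml // => i _.
by rewrite linearZ memvZ // memv_span // map_f // mem_nth.
Qed.

Lemma pair_basis (R : realType) (V V' : vectType R) (B : seq V) (B' : seq V') :
    basis_of fullv B -> basis_of fullv B' ->
  basis_of {: (V * V')%type} (map pairl B ++ map pairr B').
Proof.
move=> bB bB'; rewrite basisEdim; apply/andP; split; last first.
  rewrite size_cat !size_map dimvf /dim /= -!dimvf.
  by rewrite (size_basis (X := in_tuple B) bB) (size_basis (X := in_tuple B') bB').
apply/subvP => -[v v'] _; rewrite span_cat.
have -> : (v, v') = pairl v + pairr v' by congr pair; rewrite /= ?addr0 ?add0r.
by apply: memv_add; apply: mem_span_map.
Qed.

Lemma basis_of_subvs (R : realType) (V : vectType R) (U : {vspace V}) (X : seq V) :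
  basis_of U X -> basis_of {: subvs_of U} (map (vsproj U) X).
Proof.
move=> bX; rewrite basisEdim size_map dimvf -[X in (_ <= X)%N]/(\dim U).
rewrite (size_basis (X := in_tuple X) bX) leqnn andbT.
apply/subvP => u _; have [x xE] := coords_in_basis bX (subvsP u).
rewrite -(vsvalK u) xE linear_sum memv_suml // => i _.
by rewrite linearZ memvZ // memv_span // map_f // mem_nth.
Qed.

(** * The standard 2-step nilpotent Lie algebra *)

Theorem theorem8 (R : realType) (V : vectType R) (form : {symmetric V})
    (W : {vspace 'End(V)})
    (form_nondeg : nondegenerate form)
    (W_sub_so : {in W, forall A, skew_on form fullv A})
    (W_triple : lie_triple_system W)
    (W_centre : forall A, lie_centre W A -> A = 0)
    (W_nondeg : nondegenerate_on (@trace_form R V) W)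
    (VL_P : condition_P form W (W + liev W W)%VS) :
  exists X : seq (V * subvs_of W),
    basis_of fullv X /\ rational_structure_constants (@std_bracket R V form W) X.
Proof.
case: VL_P => N [Vs [[sumV dxV orthV] [pieces [_ [C [_ _ [X bX XC] BC]]]]]].
have [Bs bBs BsC] := fin_all_exists2 BC.
have XBs j : {in X & Bs j, forall (A : 'End(V)) b, spanQ (Bs j) (A b)}.
  move=> A b /XC[q ->] bBj; rewrite sum_lfunE; under eq_bigr do rewrite lfunE /=.
  by apply: spanQ_sum => k; apply: BsC; [rewrite mem_nth | apply: spanQ_mem].
have rat_basis j : exists2 B' : seq V, basis_of (Vs j) B' &
    {in X, forall A : 'End(V), {in B' &, forall b b', exists q, form (A b) b' = ratr q}}.
  have [_ irr nd sk] := pieces j.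
  exact: (rational_basis_of_irreducible bX (bBs j)).
have [Bs' bBs' Bs'Q] := fin_all_exists2 rat_basis.
have union_basis (F : 'I_N -> seq V) : (forall j, basis_of (Vs j) (F j)) ->
    basis_of fullv (\big[cat/[::]]_j F j).
  by rewrite -sumV => bF; apply: bigcat_basis.
(* Traces do not depend on the basis, so the given bases serve for them and the
   new ones for the pairings. *)
pose B := \big[cat/[::]]_j Bs j; pose B' := \big[cat/[::]]_j Bs' j.
have XB : {in X & B, forall (A : 'End(V)) b, spanQ B (A b)}.
  move=> A b AX /mem_bigcat_ord[j bBj].
  apply: (spanQ_map (f := idfun)) (XBs j A b AX bBj).
  by move=> c cBj; apply: spanQ_mem; apply/mem_bigcat_ord; exists j.
have traceQ : {in X &, forall A A', exists q, trace_form A A' = ratr q}.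
  move=> A A' AX A'X; have [|b bB|q qE] := @lftrace_rational R V B (A \o A')%VF.
  - exact: union_basis.
  - by rewrite lfunE /=; apply: spanQ_map (XB _ _ A'X bB) => c; apply: XB.
  by exists (- q); rewrite rmorphN /= -qE.
have formQ : {in X, forall A : 'End(V),
    {in B' &, forall b b', exists q, form (A b) b' = ratr q}}.
  move=> A AX b b' /mem_bigcat_ord[i bi] /mem_bigcat_ord[j b'j].
  have [eq_ij|neq_ij] := eqVneq i j; first by apply: Bs'Q b'j => //; rewrite -eq_ij.
  exists 0; rewrite rmorph0; have [presV _ _ _] := pieces i.
  have AbV : A b \in Vs i.
    apply: (subvP (presV _ (basis_mem bX AX))); apply: memv_img.
    exact: basis_mem bi.
  have /mem_orthovP orthAb := subvP (orthV _ _ neq_ij) _ AbV.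
  by rewrite orthAb ?(basis_mem _ b'j).
pose XW := map (vsproj W) X.
have commQ v w : {in X, forall A : 'End(V), exists q, form (A v) w = ratr q} ->
    spanQ XW (std_commutator form W v w).
  move=> vwQ; rewrite -(vsvalK (std_commutator form W v w)).
  apply: (spanQ_map (X := X)) => [A AX|]; first by apply: spanQ_mem; apply: map_f.
  apply: (spanQ_of_rational_pairings bX W_nondeg (subvsP _) traceQ) => A AX.
  have [q qE] := vwQ A AX; exists q; rewrite -qE.
  by apply: std_commutatorP => //; apply: basis_mem AX.
pose Y : seq (V * subvs_of W) := map pairl B' ++ map pairr XW.
exists Y; split.
  by apply: pair_basis; [apply: union_basis | apply: basis_of_subvs].
have YB p : p \in Y -> p.1 \in B' \/ p.1 = 0.
  by rewrite mem_cat => /orP[] /mapP[x xB ->]; [left | right].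
suff YY (ij : 'I_(size Y) * 'I_(size Y)) : spanQ Y (std_bracket form Y`_ij.1 Y`_ij.2).
  have [c cE] := fin_all_exists YY.
  by exists (fun i j => c (i, j)) => i j; apply: (cE (i, j)).
case: ij => i j; rewrite /std_bracket /=.
rewrite -/(pairr _); apply: (spanQ_map (X := XW)) => [x xX|].
  by apply: spanQ_mem; rewrite mem_cat map_f ?orbT.
apply: commQ => A AX.
have [b|->] := YB _ (mem_nth 0 (ltn_ord i)); last first.
  by exists 0; rewrite rmorph0 linear0 linear0l.
have [b'|->] := YB _ (mem_nth 0 (ltn_ord j)); last first.
  by exists 0; rewrite rmorph0 linear0r.
exact: formQ.
Qed.
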